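(* Let $\mathcal{X}\in\mathbb{C}^{m\times m}$ be a solution of the Stein matrix equation $\mathcal{X}=\mathcal{A}\mathcal{X}\mathcal{B}+\mathcal{C}$. For each positive integer $k$ let $$F_{f,k}(\mathcal{X})=\frac{1}{kn}\sum_{i=0}^{kn-1}\big(G_i(\mathcal{X})+(kn-i-1)G_i(C)\big).$$ Then the value $F_{f,k}(\mathcal{X})$ is independent of $k$, i.e. $F_{f,k}(\mathcal{X})=F_{f,1}(\mathcal{X})$ for every positive integer $k$.
   Context: Let $m,n\ge 1$ be integers, $A,B,C\in\mathbb{C}^{m\times m}$, and let $f:\mathbb{C}^{m\times m}\to\mathbb{C}^{m\times m}$ satisfy (1) (''linear'' in the paper's sense) $f(PQ+RS)=f(P)f(Q)+f(R)f(S)$ for all $P,Q,R,S\in\mathbb{C}^{m\times m}$; (2) (period-$n$) $n$ is the least positive integer such that $f^{(n)}(P)=P$ for all $P\in\mathbb{C}^{m\times m}$. Here $f^{(i)}$ is the $i$-fold composition of $f$ with itself, and $f^{(0)}$ is the identity map. For $i\ge 1$ and $X\in\mathbb{C}^{m\times m}$ set $G_i(X)=\Big(\prod_{j=1}^i f^{(j-1)}(A)\Big) f^{(i)}(X)\Big(\prod_{j=1}^i f^{(i-j)}(B)\Big)$, with products ordered from left to right in increasing $j$, i.e. $G_i(X)=A f(A)\cdots f^{(i-1)}(A)\, f^{(i)}(X)\, f^{(i-1)}(B)\cdots f(B)B$; and $G_0(X)=X$. Set $\mathcal{A}=\prod_{i=1}^n f^{(i-1)}(A)=A f(A)\cdots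 f^{(n-1)}(A)$, $\mathcal{B}=\prod_{i=1}^n f^{(n-i)}(B)=f^{(n-1)}(B)\cdots f(B)B$, and $\mathcal{C}=\sum_{i=1}^{n}G_{i-1}(C)$. ($F_{f,k}$ is the operator associated with the Stein equation obtained by composing the map $X\mapsto Af(X)B+C$ with itself $kn$ times.) *)

(* Defs.v *)
From HB Require Import structures.
From mathcomp Require Import all_boot all_order all_algebra.
From mathcomp Require Import reals complex.

Set Implicit Arguments.
Unset Strict Implicit.
Unset Printing Implicit Defensive.

Import Order.TTheory GRing.Theory Num.Theory.

Local Open Scope ring_scope.

(* The complex numbers are [R[i]] with [R : realType], i.e. R is any model of
   the (Dedekind-complete) real numbers. On ['M_m], the ring operations [*] and
   [\prod] are the matrix product and its left-to-right iteration. *)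

Section SteinOperators.
Context {R : realType} {m : nat}.
Implicit Types (f : 'M[R[i]]_m -> 'M[R[i]]_m) (A B C X : 'M[R[i]]_m).

(* This is not C-linearity: it is the multiplicative notion of a "linear"
   operator under which f acts on products. *)
Definition stein_linear f : Prop :=
  forall P Q S T : 'M[R[i]]_m, f (P * Q + S * T) = f P * f Q + f S * f T.

Definition has_period f (n : nat) : Prop :=
  [/\ (0 < n)%N,
      forall P, iter n f P = P
    & forall j : nat, (0 < j)%N -> (forall P, iter j f P = P) -> (n <= j)%N].

(* For i = 0 both products are empty, so steinG f A B 0 X = X. *)
Definition steinG f A B (i : nat) X : 'M[R[i]]_m :=
  (\prod_(1 <= j < i.+1) iter (j - 1) f A) * iter i f X
  * (\prod_(1 <= j < i.+1) iter (i - j) f B).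

Definition steinA f A (n : nat) : 'M[R[i]]_m :=
  \prod_(1 <= i < n.+1) iter (i - 1) f A.

Definition steinB f B (n : nat) : 'M[R[i]]_m :=
  \prod_(1 <= i < n.+1) iter (n - i) f B.

Definition steinC f A B C (n : nat) : 'M[R[i]]_m :=
  \sum_(1 <= i < n.+1) steinG f A B (i - 1) C.

(* The truncated subtraction is exact, since i < k * n. *)
Definition steinF f A B C (n k : nat) X : 'M[R[i]]_m :=
  (1 / (k * n)%:R) *:
    \sum_(0 <= i < k * n)
      (steinG f A B i X + (k * n - i - 1)%:R *: steinG f A B i C).

End SteinOperators.

(* Main.v *)
(* Periodicity makes f surjective, and then the identity f(PQ + RS) = f(P)f(Q) + f(R)f(S)
   forces f to be a unital ring morphism. Hence G_i is the i-th iterate of the additive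
   map U : X |-> A f(X) B, and the sum defining F_{f,k}(X) is the sum of the first kn
   iterates at X of the affine map T : X |-> U X + C. The Stein equation says T^n X = X,
   so this orbit is n-periodic and its average does not depend on k. *)

Require Import Defs.
From HB Require Import structures.
From mathcomp Require Import all_boot all_order all_algebra.
From mathcomp Require Import reals complex.

Set Implicit Arguments.
Unset Strict Implicit.
Unset Printing Implicit Defensive.

Import Order.TTheory GRing.Theory Num.Theory.

Local Open Scope ring_scope.

Section AffineIteration.
Context {V : zmodType}.
Implicit Types (U : {additive V -> V}) (T : V -> V) (C X : V).

Lemma iter_affine U C X i :
  iter i (fun Y => U Y + C) X = iter i U X + \sum_(j < i) iter j U C.
Proof.
elim: i => [|i IHi]; first by rewrite big_ord0 addr0.
by rewrite big_ord_recl iterS IHi raddfD raddf_sum -addrA [_ + C]addrC.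
Qed.

(** The term [iter i U C] occurs in the [j]-th iterate at [X] exactly when [i < j < N], hence the
    multiplicity [N - i - 1]. *)
Lemma sum_iter_affine U C X N :
  \sum_(i < N) iter i (fun Y => U Y + C) X
  = \sum_(i < N) (iter i U X + iter i U C *+ (N - i - 1)).
Proof.
elim: N => [|N IHN]; first by rewrite !big_ord0.
rewrite 2!big_ord_recr /= IHN iter_affine subSnn mulr0n addr0.
rewrite addrCA addrC -big_split /=; congr (_ + _).
apply: eq_bigr => i _; rewrite -addrA -mulrSr; congr (_ + _ *+ _).
by rewrite subSn ?subn1 /= 1?ltnW // prednK // subn_gt0.
Qed.

Lemma sum_iter_periodic T X n k : iter n T X = X ->
  \sum_(i < k * n) iter i T X = (\sum_(i < n) iter i T X) *+ k.
Proof.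
move=> TnX; elim: k => [|k IHk]; first by rewrite big_ord0.
rewrite mulSn big_split_ord /= mulrS -IHk; congr (_ + _).
by apply: eq_bigr => i _; rewrite addnC iterD TnX.
Qed.

End AffineIteration.

Section SteinOperatorTheory.
Context {R : realType} {m : nat}.
Implicit Types (A B C X : 'M[R[i]]_m).

Section PeriodicLinear.
Variables (f : 'M[R[i]]_m -> 'M[R[i]]_m) (n : nat).
Hypotheses (hlin : stein_linear f) (hper : has_period f n).

Lemma has_period_surj Y : exists X, f X = Y.
Proof.
case: hper => n_gt0 fn _; exists (iter n.-1 f Y).
by rewrite -iterS prednK.
Qed.

(** Putting 0 in all four slots gives [f 0 = f 0 * f 0 + f 0 * f 0]. Replacing one of them by a
    preimage [Q] of 0 kills a summand, so [f 0] is idempotent; thus [f 0 = f 0 + f 0]. *)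
Lemma stein_linear0 : f 0 = 0.
Proof.
have f0E : f 0 = f 0 * f 0 + f 0 * f 0 by rewrite -hlin !mul0r addr0.
have [Q fQ] := has_period_surj 0.
have f0I : f 0 = f 0 * f 0.
  by have := hlin 0 Q 0 0; rewrite !mul0r addr0 fQ mulr0 add0r.
by move: f0E; rewrite -f0I -[LHS]addr0 => /addrI/esym.
Qed.

Lemma stein_linearM P Q : f (P * Q) = f P * f Q.
Proof. by have := hlin P Q 0 0; rewrite stein_linear0 !mul0r !addr0. Qed.

Lemma stein_linear1 : f 1 = 1.
Proof.
have [P fP] := has_period_surj 1.
by have := stein_linearM P 1; rewrite mulr1 fP mul1r.
Qed.

Lemma stein_linearD P Q : f (P + Q) = f P + f Q.
Proof. by have := hlin P 1 Q 1; rewrite stein_linear1 !mulr1. Qed.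

End PeriodicLinear.

Lemma steinGE (f : {rmorphism 'M[R[i]]_m -> 'M[R[i]]_m}) A B i X :
  steinG f A B i X = iter i (B \o* (A \*o f)) X.
Proof.
have GE j : steinG f A B j X = (\prod_(l < j) iter l f A) * iter j f X
    * (\prod_(l < j) iter (j - l.+1) f B).
  rewrite /steinG !big_add1 !big_mkord; congr (_ * _ * _).
  by apply: eq_bigr => l _; rewrite subn1.
elim: i => [|i IHi]; first by rewrite GE !big_ord0 mul1r mulr1.
(* Applying [f] raises every exponent by one; the outer factors [A] and [B] supply the missing
   exponent 0, first in the left product and last in the right one. *)
rewrite iterS -IHi !GE /= big_ord_recl big_ord_recr /= subnn !rmorphM !rmorph_prod.
rewrite !mulrA; congr (_ * _ * _).
by apply: eq_bigr => l _; rewrite subSS -subnSK.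
Qed.

Lemma steinF_iter (f : {rmorphism 'M[R[i]]_m -> 'M[R[i]]_m}) A B C n k X :
  steinF f A B C n k X =
  (1 / (k * n)%:R) *: \sum_(i < k * n) iter i (fun Y => A * f Y * B + C) X.
Proof.
rewrite (sum_iter_affine (B \o* (A \*o f))) /steinF big_mkord.
by congr (_ *: _); apply: eq_bigr => i _; rewrite !steinGE scaler_nat.
Qed.

(** By [iter_affine] and [steinGE], the [n]-th iterate is [steinG f A B n X] plus
    [steinC f A B C n], and [iter n f X = X] makes this the right side of the Stein equation. *)
Lemma stein_orbit_periodic (f : {rmorphism 'M[R[i]]_m -> 'M[R[i]]_m}) A B C n X :
  iter n f X = X -> X = steinA f A n * X * steinB f B n + steinC f A B C n ->
  iter n (fun Y => A * f Y * B + C) X = X.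
Proof.
move=> fnX hX; rewrite (iter_affine (B \o* (A \*o f))) -steinGE [RHS]hX.
rewrite /steinG fnX; congr (_ + _).
rewrite /steinC big_add1 big_mkord; apply: eq_bigr => i _.
by rewrite subn1 steinGE.
Qed.

End SteinOperatorTheory.

Theorem theorem4p1 (R : realType) (m n : nat) (hm : (1 <= m)%N) (hn : (1 <= n)%N)
    (A B C : 'M[R[i]]_m) (f : 'M[R[i]]_m -> 'M[R[i]]_m)
    (hlin : stein_linear f) (hper : has_period f n)
    (X : 'M[R[i]]_m)
    (hX : X = steinA f A n * X * steinB f B n + steinC f A B C n) :
  forall k : nat, (0 < k)%N -> steinF f A B C n k X = steinF f A B C n 1 X.
Proof.
move=> k k_gt0.
have [_ fn _] := hper.
(* [g] is [f] bundled with its ring morphism structure; the two are convertible, so [hX] and the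
   goal apply to [g] unchanged. *)
pose fM := GRing.isMonoidMorphism.Build _ _ f
  (stein_linear1 hlin hper, stein_linearM hlin hper).
pose fD := GRing.isNmodMorphism.Build _ _ f
  (stein_linear0 hlin hper, stein_linearD hlin hper).
pose g : {rmorphism 'M[R[i]]_m -> 'M[R[i]]_m} := HB.pack f fD fM.
have TnX := stein_orbit_periodic (f := g) (fn X) hX.
rewrite !(steinF_iter g) !sum_iter_periodic // mul1n mulr1n.
(* The factor [k] from the [k] equal blocks of the orbit cancels against [1 / (k * n)]. *)
rewrite -[X in _ *: X = _]scaler_nat scalerA; congr (_ *: _).
have k_neq0 : (k%:R : R[i]) != 0 by rewrite pnatr_eq0 -lt0n.
by rewrite natrM !div1r invfM mulrAC mulVf // mul1r.
Qed.
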